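(* The structure $(\mathcal{S}_{\mathbb{N}^*},\prec,\succ,\cdot)$, where $\mathcal{S}_{\mathbb{N}^*}$ is the space of formal series $\sum_{1\le n_r<\dots<n_1}\prod_{i=1}^r f_{\omega_i}$ attached to the map $F:k\mapsto(n\mapsto n^{-k})$ and $\prec,\succ,\cdot$ are the products on it given by sums over quasi-shuffles, is an (augmented) tridendriform algebra.
   Context: **Tridendriform algebras.** A tridendriform algebra is a vector space $A$ with bilinear operations $\prec,\cdot,\succ$ such that, with $x*y:=x\prec y+x\cdot y+x\succ y$, for all $x,y,z\in A$: $(x\prec y)\prec z=x\prec(y*z)$; $(x\succ y)\prec z=x\succ(y\prec z)$; $(x*y)\succ z=x\succ(y\succ z)$; $(x\succ y)\cdot z=x\succ(y\cdot z)$; $(x\prec y)\cdot z=x\cdot(y\succ z)$; $(x\cdot y)\prec z=x\cdot(y\prec z)$; $(x\cdot y)\cdot z=x\cdot(y\cdot z)$. The associated augmented tridendriform algebra is $\overline A=A\oplus\mathbb{K}1$ ($\mathbb K$ the ground field), with the products extended by $1\prec a=0=a\succ 1$, $a\prec 1=a=1\succ a$, $a\cdot 1=0=1\cdot a$ for $a\in A$ (products of $1$ with itself by $\prec,\succ,\cdot$ are not defined; $1*1=1$). Convention: ''tridendriform algebra'' always means augmented tridendriform algebra. **Words.** $\mathbb{N}^*=\{1,2,\dots\}$; $\mathcal{W}_{\mathbb{N}^*}$ is the vector space with basis the finite words on the alphabet $\mathbb{N}^*$; $\emptyset$ is the empty word; $\ell(w)$ is the length of a word $w$. **Formal series.** For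 $d\in\mathbb{N}$, let $\mathbb{R}\mathcal{P}(\mathbb{N}^d)$ be the real vector space with basis the power set of $\mathbb{N}^d$, an algebra for the bilinear extension of $\cup$, and let $J_d$ be its ideal generated by the elements $A\cup B-A-B+A\cap B$, $A,B\subseteq\mathbb{N}^d$. A formal series is a pair $(A\otimes w,F)$ in $\big\langle (\mathbb{R}\mathcal{P}(\mathbb{N}^{\ell(w)})/J_{\ell(w)})\otimes w \mid w\in\mathcal{W}_{\mathbb{N}^*}\text{ a word}\big\rangle\times(\mathbb{N}^*\to\mathbb{R})^{\mathbb{N}^*}$, also written $A\otimes w\times F$ or, for $w=w_1\cdots w_k$ and $f_n:=F(n)$, $\sum_A\prod_{i=1}^k f_{w_i}$. It is a purely formal object. Here $F$ is fixed: $F(k)=f_k=(n\mapsto n^{-k})$, and vector space operations are those of the first factor. $\mathcal{S}_{\mathbb{N}^*}$ is the subspace spanned by all $$\sum_{1\le n_r<\dots<n_1}\prod_{i=1}^r f_{\omega_i}:=\{(n_1,\dots,n_r):1\le n_r<\dots<n_1\}\otimes\omega_1\cdots\omega_r\times F,\qquad r\ge 0,\ \omega_i\in\mathbb{N}^*;$$ the element for $r=0$, namely $\emptyset\otimes\emptyset\times F$, is the unit $1$. **Quasi-shuffles.** For $k,l\ge1$, $\mathrm{Qsh}(k,l)$ is the set of surjections $\sigma:\{1,\dots,k+l\}\to\{1,\dots,n\}$ (for some $n=\max(\sigma)$) with $\sigma(1)<\dots<\sigma(k)$ and $\sigma(k+1)<\dots<\sigma(k+l)$. **Products on $\mathcal{S}_{\mathbb{N}^*}$.**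 For $\alpha=\sum_{1\le n_k<\dots<n_1}\prod_{i=1}^k f_{\omega_i}$ and $\beta=\sum_{1\le n_{k+l}<\dots<n_{k+1}}\prod_{i=k+1}^{k+l}f_{\omega_i}$ with $k,l\ge1$, each of $\alpha\prec\beta$, $\alpha\succ\beta$, $\alpha\cdot\beta$ is $$\sum_{\sigma}\ \sum_{1\le n_{\max(\sigma)}<\dots<n_1}\ \prod_{i=1}^{\max(\sigma)}f_{\omega_{\sigma^{-1}(\{i\})}},$$ where $\sigma$ runs over the elements of $\mathrm{Qsh}(k,l)$ with, respectively, $\sigma^{-1}(\{1\})=\{1\}$, $\sigma^{-1}(\{1\})=\{k+1\}$, $\sigma^{-1}(\{1\})=\{1,k+1\}$. Here $\omega_{\{i\}}=\omega_i$ and $\omega_{\{i,j\}}=\omega_i+\omega_j$. These are extended bilinearly, and to the unit as in an augmented tridendriform algebra. *)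

(* Defs.v *)
From HB Require Import structures.
From mathcomp Require Import all_boot all_order all_algebra finmap.
From mathcomp Require Import monalg.
From mathcomp Require Import boolp classical_sets functions cardinality reals.

Set Implicit Arguments.
Unset Strict Implicit.
Unset Printing Implicit Defensive.

Import GRing.Theory.

Local Open Scope classical_set_scope.
Local Open Scope ring_scope.

Section Tridendriform.
Variables (K : fieldType) (V : lmodType K).
Implicit Types (A : set V) (D : V -> V -> Prop) (op : V -> V -> V).

Definition subspace A : Prop :=
  A 0 /\ forall c x y, A x -> A y -> A (c *: x + y).

Definition spanned_by (G : set V) : set V := smallest subspace G.

(* Bilinearity of a product which is only meaningful on the pairs in D. *)
Definition bilinear_on D op : Prop :=
  (forall c x x' y, D x y -> D x' y ->
     op (c *: x + x') y = c *: op x y + op x' y) /\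
  (forall c x y y', D x y -> D x y' ->
     op x (c *: y + y') = c *: op x y + op x y').

Definition sum_product (prec dot succ : V -> V -> V) (x y : V) : V :=
  prec x y + dot x y + succ x y.

Record tridendriform_on A (prec dot succ : V -> V -> V) : Prop := {
  tri_subspace : subspace A;
  tri_prec_closed : forall x y, A x -> A y -> A (prec x y);
  tri_dot_closed : forall x y, A x -> A y -> A (dot x y);
  tri_succ_closed : forall x y, A x -> A y -> A (succ x y);
  tri_prec_bilinear : bilinear_on (fun x y => A x /\ A y) prec;
  tri_dot_bilinear : bilinear_on (fun x y => A x /\ A y) dot;
  tri_succ_bilinear : bilinear_on (fun x y => A x /\ A y) succ;
  tri_prec_prec : forall x y z, A x -> A y -> A z ->
    prec (prec x y) z = prec x (sum_product prec dot succ y z);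
  tri_succ_prec : forall x y z, A x -> A y -> A z ->
    prec (succ x y) z = succ x (prec y z);
  tri_succ_succ : forall x y z, A x -> A y -> A z ->
    succ (sum_product prec dot succ x y) z = succ x (succ y z);
  tri_succ_dot : forall x y z, A x -> A y -> A z ->
    dot (succ x y) z = succ x (dot y z);
  tri_prec_dot : forall x y z, A x -> A y -> A z ->
    dot (prec x y) z = dot x (succ y z);
  tri_dot_prec : forall x y z, A x -> A y -> A z ->
    prec (dot x y) z = dot x (prec y z);
  tri_dot_dot : forall x y z, A x -> A y -> A z ->
    dot (dot x y) z = dot x (dot y z)
}.

(* V is A (+) K.one.  The three products are undefined on (one, one): as      *)
(* functions on V x V they are constrained only on the pairs (x, y) with x in *)
(* A or y in A.  Their sum alone extends to V x V, by one * one = one.        *)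
Record augmented_tridendriform A (one : V) (prec dot succ : V -> V -> V) :
    Prop := {
  aug_tridendriform : tridendriform_on A prec dot succ;
  aug_direct : ~ A one;
  aug_sum : forall v, exists a c, A a /\ v = a + c *: one;
  aug_prec_bilinear : bilinear_on (fun x y => A x \/ A y) prec;
  aug_dot_bilinear : bilinear_on (fun x y => A x \/ A y) dot;
  aug_succ_bilinear : bilinear_on (fun x y => A x \/ A y) succ;
  aug_one_prec : forall a, A a -> prec one a = 0;
  aug_succ_one : forall a, A a -> succ a one = 0;
  aug_prec_one : forall a, A a -> prec a one = a;
  aug_one_succ : forall a, A a -> succ one a = a;
  aug_dot_one : forall a, A a -> dot a one = 0;
  aug_one_dot : forall a, A a -> dot one a = 0;
  aug_star : exists star : V -> V -> V,
    [/\ bilinear_on (fun _ _ => True) star,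
        forall x y, A x \/ A y -> star x y = sum_product prec dot succ x y
      & star one one = one]
}.

End Tridendriform.

Section DirectSum.
Variables (R : nzRingType) (I : eqType) (Q : I -> lmodType R).

Definition dprod : Type := forall i, Q i.

HB.instance Definition _ := gen_eqMixin dprod.
HB.instance Definition _ := gen_choiceMixin dprod.

Implicit Types f g h : dprod.

Let dadd f g : dprod := fun i => f i + g i.
Let dopp f : dprod := fun i => - f i.
Let dzero : dprod := fun i => 0.
Let dscale (c : R) f : dprod := fun i => c *: f i.

Let daddA : associative dadd.
Proof. by move=> f g h; apply: functional_extensionality_dep => i; exact: addrA. Qed.
Let daddC : commutative dadd.
Proof. by move=> f g; apply: functional_extensionality_dep => i; exact: addrC. Qed.
Let dadd0 : left_id dzero dadd.
Proof. by move=> f; apply: functional_extensionality_dep => i; exact: add0r. Qed.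
Let daddN : left_inverse dzero dopp dadd.
Proof. by move=> f; apply: functional_extensionality_dep => i; exact: addNr. Qed.

HB.instance Definition _ := GRing.isZmodule.Build dprod daddA daddC dadd0 daddN.

Let dscaleA c d f : dscale c (dscale d f) = dscale (c * d) f.
Proof. by apply: functional_extensionality_dep => i; exact: scalerA. Qed.
Let dscale1 : left_id 1 dscale.
Proof. by move=> f; apply: functional_extensionality_dep => i; exact: scale1r. Qed.
Let dscaleDr : right_distributive dscale +%R.
Proof. by move=> c f g; apply: functional_extensionality_dep => i; exact: scalerDr. Qed.
Let dscaleDl f : {morph dscale^~ f : c d / c + d}.
Proof. by move=> c d; apply: functional_extensionality_dep => i; exact: scalerDl. Qed.

HB.instance Definition _ := GRing.Zmodule_isLmodule.Build R dprod
  dscaleA dscale1 dscaleDr dscaleDl.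

Definition finitely_supported : {pred dprod} :=
  fun f => `[< finite_set [set i | f i <> 0] >].

Lemma finitely_supported_submod : submod_closed finitely_supported.
Proof.
split=> [|c f g /asboolP ff /asboolP fg].
  by apply/asboolP; apply: (@sub_finite_set _ _ set0) => // i /=.
apply/asboolP; apply: (@sub_finite_set _ _
  ([set i | f i <> 0] `|` [set i | g i <> 0])); last by rewrite finite_setU.
move=> i /= nz; apply: contrapT => /not_orP[/contrapT fi0 /contrapT gi0].
by apply: nz; rewrite /GRing.add /= /dadd /GRing.scale /= /dscale fi0 gi0 scaler0 addr0.
Qed.

HB.instance Definition _ :=
  GRing.isSubmodClosed.Build R dprod finitely_supported finitely_supported_submod.

Record dsum := DSum { dsum_val :> dprod; _ : dsum_val \in finitely_supported }.

HB.instance Definition _ := [isSub for dsum_val].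
HB.instance Definition _ := [Choice of dsum by <:].
HB.instance Definition _ := [SubChoice_isSubLmodule of dsum by <:].

Lemma dsum_in_subproof i (x : Q i) :
  (dfwith (fun=> 0) x : dprod) \in finitely_supported.
Proof.
apply/asboolP; apply: (sub_finite_set _ (finite_set1 i)) => j /= nz.
by apply: contrapT => ji; apply: nz; rewrite dfwith_out //; apply/eqP => ij; apply: ji.
Qed.

Definition dsum_in i (x : Q i) : dsum := DSum (dsum_in_subproof x).

End DirectSum.

Section LmodQuotient.
Variables (K : fieldType) (V : lmodType K) (A : set V) (subA : subspace A).

Definition subspace_pred & subspace A : {pred V} := fun x => `[< A x >].
Let W := subspace_pred subA.

Lemma subspace_predP x : reflect (A x) (x \in W).
Proof. exact: asboolP. Qed.

Lemma subspace_pred_submod : submod_closed W.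
Proof.
case: subA => A0 Alin; split=> [|c x y /subspace_predP Ax /subspace_predP Ay].
  exact/subspace_predP.
by apply/subspace_predP; exact: Alin.
Qed.

HB.instance Definition _ :=
  GRing.isSubmodClosed.Build K V (subspace_pred subA) subspace_pred_submod.

Definition lquot : Type := Quotient.quot (subspace_pred subA).
HB.instance Definition _ := GRing.Zmodule.on lquot.

Definition lquot_class (x : V) : lquot :=
  \pi_(Quotient.quot (subspace_pred subA))%qT x.

Lemma lquot_classB : {morph lquot_class : x y / x - y}.
Proof. by move=> x y; rewrite /lquot_class -raddfB. Qed.

Lemma lquot_classD : {morph lquot_class : x y / x + y}.
Proof. by move=> x y; rewrite /lquot_class -raddfD. Qed.

Lemma lquot_classP x y : lquot_class x = lquot_class y <-> A (x - y).
Proof.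
split=> [/eqP|Axy].
  by rewrite -Quotient.idealrBE => /subspace_predP.
by apply/eqP; rewrite -Quotient.idealrBE; exact/subspace_predP.
Qed.

Lemma lquot_classK x : lquot_class (repr (x : Quotient.quot (subspace_pred subA))) = x.
Proof. exact: reprK. Qed.

Let qscale (c : K) (q : lquot) : lquot :=
  lquot_class (c *: repr (q : Quotient.quot (subspace_pred subA))).

Lemma lquot_classZ_subproof c x :
  qscale c (lquot_class x) = lquot_class (c *: x).
Proof.
apply/lquot_classP; rewrite -scalerBr -[_ *: _]addr0.
apply: subA.2; last exact: subA.1.
by apply/lquot_classP; exact: lquot_classK.
Qed.

Let qsurj q : exists x, q = lquot_class x.
Proof. by eexists; rewrite -{1}(lquot_classK q). Qed.

Let qscaleA c d q : qscale c (qscale d q) = qscale (c * d) q.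
Proof. by have [x ->] := qsurj q; rewrite !lquot_classZ_subproof scalerA. Qed.
Let qscale1 : left_id 1 qscale.
Proof. by move=> q; have [x ->] := qsurj q; rewrite lquot_classZ_subproof scale1r. Qed.
Let qscaleDr : right_distributive qscale +%R.
Proof.
move=> c q r; have [x ->] := qsurj q; have [y ->] := qsurj r.
by rewrite -lquot_classD !lquot_classZ_subproof scalerDr lquot_classD.
Qed.
Let qscaleDl q : {morph qscale^~ q : c d / c + d}.
Proof.
move=> c d; have [x ->] := qsurj q.
by rewrite !lquot_classZ_subproof scalerDl lquot_classD.
Qed.

HB.instance Definition _ := GRing.Zmodule_isLmodule.Build K lquot
  qscaleA qscale1 qscaleDr qscaleDl.

Lemma lquot_class_is_linear : linear lquot_class.
Proof. by move=> c x y; rewrite lquot_classD -lquot_classZ_subproof. Qed.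

HB.instance Definition _ :=
  GRing.isLinear.Build K V lquot _ lquot_class lquot_class_is_linear.

End LmodQuotient.

Definition posn := {n : nat | (0 < n)%N}.
HB.instance Definition _ := Countable.on posn.

Definition posn1 : posn := exist (fun n => is_true (0 < n)%N) 1%N isT.

Lemma posn_add_subproof (a b : posn) : (0 < val a + val b)%N.
Proof. by rewrite addn_gt0 (valP a). Qed.

Definition posn_add (a b : posn) : posn :=
  exist (fun n => is_true (0 < n)%N) _ (posn_add_subproof a b).

Definition word := seq posn.
HB.instance Definition _ := Countable.on word.

Definition powset (d : nat) : Type := set (d.-tuple nat).
HB.instance Definition _ d := Choice.on (powset d).

Section PowsetMonoid.
Variable d : nat.

Let union : powset d -> powset d -> powset d := setU.
Let unionA : associative union. Proof. exact: setUA. Qed.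
Let union0 : left_id (set0 : powset d) union. Proof. exact: set0U. Qed.
Let union0r : right_id (set0 : powset d) union. Proof. exact: setU0. Qed.
Let unionC : commutative union. Proof. exact: setUC. Qed.
Let union_eq0 (A B : powset d) : union A B = set0 -> A = set0 /\ B = set0.
Proof. by rewrite /union setU_eq0. Qed.

HB.instance Definition _ :=
  Choice_isMonomialDef.Build (powset d) unionA union0 union0r union_eq0.
HB.instance Definition _ := MonomialDef_isConomialDef.Build (powset d) unionC.

End PowsetMonoid.

Section FormalSeries.
Variable R : realType.

(* The monoid algebra of (P(N^d), `|`): << A >> * << B >> = << A `|` B >>. *)
Definition powset_algebra (d : nat) := {malg R[powset d]}.
HB.instance Definition _ d := GRing.ComNzRing.on (powset_algebra d).
HB.instance Definition _ d := GRing.Lmodule.on (powset_algebra d).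

Definition ideal d (J : set (powset_algebra d)) : Prop :=
  [/\ J 0, forall x y, J x -> J y -> J (x + y)
    & forall a x, J x -> J (a * x)].

Definition incl_excl_ideal d : set (powset_algebra d) :=
  smallest (@ideal d)
    [set x | exists A B : powset d,
       x = << (A `|` B : powset d) >> - << A >> - << B >>
           + << (A `&` B : powset d) >>].

Lemma incl_excl_subspace d : subspace (@incl_excl_ideal d).
Proof.
split=> [J [[J0 _ _] _] //|c x y Jx Jy J [idJ sJ]].
have [_ JD JM] := idJ.
by apply: JD; [rewrite -mul_malgC; apply: JM; exact: Jx | exact: Jy].
Qed.

Definition powset_quot (d : nat) := lquot (@incl_excl_subspace d).
HB.instance Definition _ d := GRing.Lmodule.on (powset_quot d).

(* The tensor product Q (x) w with the line spanned by a word w is Q itself,  *)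
(* placed in the summand indexed by w.                                        *)
Definition series_space := dsum (fun w : word => powset_quot (size w)).
HB.instance Definition _ := GRing.Lmodule.on series_space.

Definition tensor_word (w : word) (A : powset (size w)) : series_space :=
  @dsum_in R _ (fun w : word => powset_quot (size w)) w
    (lquot_class (@incl_excl_subspace (size w)) << A >>).

Definition formal_series : Type := (series_space * (posn -> posn -> R))%type.

(* The formal series (x, F) with second factor F; the vector space structure  *)
(* is the one of the first factor.                                            *)
Definition series_over (F : posn -> posn -> R) : Type := series_space.
HB.instance Definition _ F := GRing.Lmodule.on (series_over F).

Definition to_formal_series F (x : series_over F) : formal_series := (x, F).

Definition power_functions : posn -> posn -> R :=
  fun k n => (val n)%:R ^- val k.

Definition decreasing_tuples (r : nat) : powset r :=
  [set n : r.-tuple nat | (forall i, (1 <= tnth n i)%N) /\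
     (forall i j : 'I_r, (i < j)%N -> (tnth n j < tnth n i)%N)].

(* For the empty word the first factor is the empty subset of N^0 (the unit   *)
(* of the union product), and not the whole one-point space N^0.              *)
Definition chain_set (r : nat) : powset r :=
  match r with 0 => set0 | r'.+1 => @decreasing_tuples r'.+1 end.

Definition chain_series (w : word) : series_over power_functions :=
  tensor_word (@chain_set (size w)).

Definition chain_span : set (series_over power_functions) :=
  spanned_by (range chain_series).

Lemma chain_span_subspace : subspace chain_span.
Proof.
split=> [J [[J0 _] _] //|c x y Sx Sy J [subJ sJ]].
by apply: subJ.2; [exact: Sx | exact: Sy].
Qed.

Record chain_space := ChainSpace {
  chain_val :> series_over power_functions;
  _ : chain_val \in subspace_pred chain_span_subspace }.

HB.instance Definition _ := [isSub for chain_val].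
HB.instance Definition _ := [Choice of chain_space by <:].
HB.instance Definition _ := [SubChoice_isSubLmodule of chain_space by <:].

Lemma chain_subproof w :
  chain_series w \in subspace_pred chain_span_subspace.
Proof. by apply/subspace_predP; apply: sub_gen_smallest; exists w. Qed.

Definition chain (w : word) : chain_space := ChainSpace (chain_subproof w).

(* A |-> 1 is a valuation, hence defines a linear form on each quotient; these *)
(* forms show that the spanning elements [chain w] are linearly independent,   *)
(* so that products defined on them extend bilinearly.                         *)

Section Counit.
Variable d : nat.

Definition counit_mono : powset d -> R := fun=> 1.

Lemma counit_mono_morph : mmorphism counit_mono.
Proof. by split=> // A B; rewrite /counit_mono mulr1. Qed.

HB.instance Definition _ :=
  monalg.isMultiplicative.Build (powset d) R counit_mono counit_mono_morph.

Definition counit : powset_algebra d -> R := mmap idfun counit_mono.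

Lemma counitU A : counit << A >> = 1.
Proof. by rewrite /counit mmapU /= mulr1. Qed.

Lemma counitB x y : counit (x - y) = counit x - counit y.
Proof. exact: raddfB. Qed.

Lemma counitD x y : counit (x + y) = counit x + counit y.
Proof. exact: raddfD. Qed.

Lemma counitM x y : counit (x * y) = counit x * counit y.
Proof. exact: rmorphM. Qed.

Lemma counitZ c x : counit (c *: x) = c * counit x.
Proof. exact: linearZ. Qed.

Lemma counit_ideal x : @incl_excl_ideal d x -> counit x = 0.
Proof.
apply: (@smallest_sub _ _ _ [set x | counit x = 0]).
  split=> /= [|y z y0 z0|a y y0].
  - exact: raddf0.
  - by rewrite counitD y0 z0 addr0.
  - by rewrite counitM y0 mulr0.
by move=> _ /= [A [B ->]]; rewrite counitD !counitB !counitU subrr sub0r addNr.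
Qed.

Definition quot_counit (q : powset_quot d) : R :=
  counit (repr (q : Quotient.quot (subspace_pred (@incl_excl_subspace d)))).

Lemma quot_counit_class x :
  quot_counit (lquot_class (@incl_excl_subspace d) x) = counit x.
Proof.
apply/eqP; rewrite -subr_eq0 -counitB; apply/eqP; apply: counit_ideal.
by apply/(lquot_classP (@incl_excl_subspace d)); exact: lquot_classK.
Qed.

Lemma quot_counit_linear : linear_for *%R quot_counit.
Proof.
move=> c x y; rewrite -(lquot_classK x) -(lquot_classK y) -linearP.
by rewrite !quot_counit_class counitD counitZ.
Qed.

End Counit.

Definition word_coord (w : word) (x : series_over power_functions) : R :=
  quot_counit (dsum_val x w).

Lemma word_coord_linear w : linear_for *%R (word_coord w).
Proof. by move=> c x y; rewrite /word_coord -quot_counit_linear. Qed.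

HB.instance Definition _ w :=
  GRing.isLinear.Build R (series_over power_functions) R *%R (word_coord w)
    (word_coord_linear w).

Lemma word_coord_chain w v : word_coord w (chain_series v) = (v == w)%:R.
Proof.
rewrite /word_coord /chain_series /tensor_word /=.
case: eqVneq => [<-|vw]; first by rewrite dfwith_in quot_counit_class counitU.
rewrite dfwith_out // -(linear0 (@lquot_class _ _ _ (@incl_excl_subspace (size w)))).
by rewrite quot_counit_class /counit raddf0.
Qed.

Definition chain_sum (c : {malg R[word]}) : chain_space :=
  \sum_(w <- msupp c) c@_w *: chain w.

Lemma chain_val_sum (c : {malg R[word]}) (d : {fset word}) :
  fsubset (msupp c) d ->
  chain_val (chain_sum c) = \sum_(w <- d) c@_w *: chain_series w.
Proof.
move=> cd; rewrite -[LHS]/(val (chain_sum c)) raddf_sum /= (big_fset_incl _ cd) //= => w _ /mcoeff_outdom ->.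
by rewrite scale0r.
Qed.

Lemma word_coord_sum w c : word_coord w (chain_sum c) = c@_w.
Proof.
rewrite (chain_val_sum (fsubset_refl _)) linear_sum /= [in RHS](monalgE c).
rewrite raddf_sum /=; apply: eq_bigr => v _.
by rewrite linearZ /= word_coord_chain mcoeffU mulr_natr.
Qed.

Lemma chain_sum_inj : injective chain_sum.
Proof.
by move=> c d cd; apply/malgP => w; rewrite -!word_coord_sum cd.
Qed.

Lemma chain_sum_linear : linear chain_sum.
Proof.
move=> a c d; apply: val_inj; rewrite linearP /=.
set E := fsetU (msupp (a *: c + d)) (fsetU (msupp c) (msupp d)).
rewrite (@chain_val_sum _ E) ?fsubsetUl // !(@chain_val_sum _ E).
- rewrite scaler_sumr -big_split /=.
  by apply: eq_bigr => w _; rewrite mcoeffD mcoeffZ scalerDl scalerA.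
- by apply: (fsubset_trans _ (fsubsetUr _ _)); exact: fsubsetUr.
- by apply: (fsubset_trans _ (fsubsetUr _ _)); exact: fsubsetUl.
Qed.

HB.instance Definition _ :=
  GRing.isLinear.Build R {malg R[word]} chain_space _ chain_sum chain_sum_linear.

Lemma chain_sumU w : chain_sum << w >> = chain w.
Proof. by rewrite /chain_sum msuppU oner_eq0 big_seq_fset1 mcoeffUU scale1r. Qed.

Lemma chain_sum_surj x : exists c, chain_sum c = x.
Proof.
suff [c cx] : exists c, chain_val (chain_sum c) = chain_val x.
  by exists c; exact: val_inj.
case: x => x /= /subspace_predP.
apply: (@smallest_sub _ _ _ [set y | exists c, chain_val (chain_sum c) = y]).
  split=> [|a _ _ [c <-] [d <-]]; first by exists 0; rewrite linear0.
  by exists (a *: c + d); rewrite linearP.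
by move=> _ [w _ <-]; exists << w >>; rewrite chain_sumU.
Qed.

Definition chain_coords (x : chain_space) : {malg R[word]} :=
  projT1 (cid (chain_sum_surj x)).

Lemma chain_coordsK : cancel chain_coords chain_sum.
Proof. by move=> x; rewrite /chain_coords; case: cid. Qed.

Lemma chain_sumK : cancel chain_sum chain_coords.
Proof. by move=> c; apply: chain_sum_inj; rewrite chain_coordsK. Qed.

Lemma chain_coords_chain w : chain_coords (chain w) = << w >>.
Proof. by rewrite -chain_sumU chain_sumK. Qed.

Definition bilinear_ext (f : word -> word -> chain_space) (x y : chain_space) :
    chain_space :=
  \sum_(u <- msupp (chain_coords x)) \sum_(v <- msupp (chain_coords y))
    ((chain_coords x)@_u * (chain_coords y)@_v) *: f u v.

Lemma bilinear_ext_chain f u v : bilinear_ext f (chain u) (chain v) = f u v.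
Proof.
rewrite /bilinear_ext !chain_coords_chain !msuppU oner_eq0 !big_seq_fset1 !mcoeffUU.
by rewrite mulr1 scale1r.
Qed.

End FormalSeries.

(* Indices start at 0 here: sigma maps {0, .., k+l-1} onto {0, .., n-1}.      *)
Definition is_qsh (k l n : nat) (sigma : {ffun 'I_(k + l) -> 'I_n}) : bool :=
  [&& [forall j, exists i, sigma i == j],
      [forall i : 'I_k, forall j : 'I_k,
         (i < j)%N ==> (sigma (lshift l i) < sigma (lshift l j))%N]
    & [forall i : 'I_l, forall j : 'I_l,
         (i < j)%N ==> (sigma (rshift k i) < sigma (rshift k j))%N]].

(* omega_{i} = omega_i and omega_{i, j} = omega_i + omega_j; the fibres of a  *)
(* quasi-shuffle have one or two elements, so the last case does not occur.   *)
Definition block_letter (k : nat) (w : word) (A : {set 'I_k}) : posn :=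
  match [seq nth posn1 w (val i) | i <- enum A] with
  | [:: a] => a
  | [:: a; b] => posn_add a b
  | _ => posn1
  end.

Definition qsh_word (k n : nat) (w : word) (sigma : {ffun 'I_k -> 'I_n}) : word :=
  [seq block_letter w [set i | sigma i == j]%SET | j <- enum 'I_n].

Section Products.
Variable R : realType.
Implicit Types u v : word.

(* The sum over the quasi-shuffles with sigma^{-1}(first index) = first.      *)
(* For k, l >= 1 the maximum n.+1 of sigma is between 1 and k + l.            *)
Definition qsh_sum u v (first : {set 'I_(size u + size v)}) : chain_space R :=
  \sum_(n < size u + size v)
    \sum_(sigma : {ffun 'I_(size u + size v) -> 'I_n.+1} |
           is_qsh sigma && ([set i | sigma i == ord0]%SET == first))
      chain R (qsh_word (u ++ v) sigma).

(* The value 0 for two empty words is a dummy, these products of 1 with itself *)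
(* being undefined; [augmented_tridendriform] does not look at it.             *)
Definition word_prec u v : chain_space R :=
  match u, v with
  | [::], _ => 0
  | _, [::] => chain R u
  | _, _ => @qsh_sum u v [set i | val i == 0%N]%SET
  end.

Definition word_succ u v : chain_space R :=
  match u, v with
  | _, [::] => 0
  | [::], _ => chain R v
  | _, _ => @qsh_sum u v [set i | val i == size u]%SET
  end.

Definition word_dot u v : chain_space R :=
  match u, v with
  | [::], _ | _, [::] => 0
  | _, _ => @qsh_sum u v [set i | (val i == 0%N) || (val i == size u)]%SET
  end.

Definition series_prec : chain_space R -> chain_space R -> chain_space R :=
  bilinear_ext word_prec.
Definition series_dot : chain_space R -> chain_space R -> chain_space R :=
  bilinear_ext word_dot.
Definition series_succ : chain_space R -> chain_space R -> chain_space R :=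
  bilinear_ext word_succ.

Definition series_one : chain_space R := chain R [::].

Definition positive_chains : set (chain_space R) :=
  spanned_by [set x | exists2 w : word, (0 < size w)%N & x = chain R w].

End Products.

(* Main.v *)
(* A quasi-shuffle of two words amounts to a Delannoy path, and deleting the  *)
(* first step of the path gives, for letters a, b and words u, v,             *)
(*   au < v = a(u * v),   u > bv = b(u * v),   au . bv = (a + b)(u * v).      *)
(* Hence au * bv = a(u * bv) + (a + b)(u * v) + b(au * v), from which * is    *)
(* associative by induction on the total length.  Each of the seven axioms    *)
(* then reads c((x * y) * z) = c(x * (y * z)) for some letter c and some      *)
(* x, y, z.                                                                   *)

Require Import Defs.
From HB Require Import structures.
From mathcomp Require Import all_boot all_algebra finmap.
From mathcomp Require Import monalg zify.
From mathcomp Require Import boolp classical_sets reals.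

Set Implicit Arguments.
Unset Strict Implicit.
Unset Printing Implicit Defensive.

(** A quasi-shuffle is recovered from the list that tells, for each value, which halves of the
    domain hit it: an increasing map is determined by its image. This identifies quasi-shuffles with
    Delannoy paths ([qsh_path_mem], [qsh_path_inj], [qsh_path_surj]). Prescribing the fibre of the
    first value means prescribing the first step, so every product of nonempty words puts one letter
    in front of a full quasi-shuffle product ([qsh_sumE]).

    Extended linearly, this gives [prec_prepend], [succ_prepend] and [dot_prepend]. Applied to the
    elements [prepend a x], which span the positive part, they pull one letter out of both sides of
    each of the seven axioms. What remains is the associativity of [⋆] ([starA]) and, for the last
    axiom, that of the addition of letters. The associativity of [⋆] follows from the three-term
    recursion [star_prepend] by induction on total length, the empty word being the unit. The
    relations with the unit are clauses of the word products, and the unit is not positive because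
    the coordinate at the empty word vanishes on positive elements. *)

(* A step records which of the two words contribute a letter.  The Delannoy   *)
(* paths from (0, 0) to (k, l) encode the quasi-shuffles in Qsh(k, l), the    *)
(* j-th step telling which of the two halves of the domain meet the fibre of  *)
(* j.                                                                         *)
Definition steps := seq (bool * bool).

(** * Delannoy paths and the words they spell *)

Fixpoint delannoy (k l : nat) : seq steps :=
  match k with
  | 0 => [:: nseq l (false, true)]
  | k'.+1 =>
    (fix delannoy_k l := match l with
     | 0 => [:: nseq k'.+1 (true, false)]
     | l'.+1 => map (cons (true, false)) (delannoy k' l'.+1) ++
                map (cons (false, true)) (delannoy_k l') ++
                map (cons (true, true)) (delannoy k' l')
     end) l
  end.

Lemma delannoy0 k : delannoy k 0 = [:: nseq k (true, false)].
Proof. by case: k. Qed.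

Lemma delannoySS k l : delannoy k.+1 l.+1 =
  map (cons (true, false)) (delannoy k l.+1) ++
  map (cons (false, true)) (delannoy k.+1 l) ++ map (cons (true, true)) (delannoy k l).
Proof. by []. Qed.

Lemma mem_map_cons (T : eqType) (x y : T) (s : seq T) (S : seq (seq T)) :
  (x :: s \in map (cons y) S) = (x == y) && (s \in S).
Proof.
apply/mapP/andP => [[t tS [-> ->]]|[/eqP -> sS]]; first by rewrite eqxx.
by exists s.
Qed.

Lemma nil_map_cons (T : eqType) (y : T) (S : seq (seq T)) :
  ([::] \in map (cons y) S) = false.
Proof. by apply/mapP => -[]. Qed.

(** This description without recursion is what quasi-shuffles are compared with: surjectivity
    forbids the step [(false, false)], and the two counts are the sizes of the two images. *)
Lemma mem_delannoy k l p : (p \in delannoy k l) =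
  [&& all (fun s => s.1 || s.2) p, count fst p == k & count snd p == l].
Proof.
elim: k l p => [|k IHk] l p.
  by rewrite inE; elim: p l => [|[[] []] p IHp] [|l] //=;
    rewrite ?eqseq_cons ?IHp ?andbF // !add0n add1n eqSS.
elim: l p => [|l IHl] p.
  rewrite inE; elim: p (k.+1) {IHk} => [|[[] []] p IHp] [|m] //=;
    rewrite ?eqseq_cons ?IHp ?andbF // !add0n add1n eqSS.
rewrite delannoySS !mem_cat; case: p => [|s p]; first by rewrite !nil_map_cons.
rewrite !mem_map_cons !IHk IHl; case: s => [[] []] //=; rewrite ?orbF ?andbF //.
Qed.

Lemma uniq_delannoy k l : uniq (delannoy k l).
Proof.
have consI s : injective (cons s : steps -> steps) by move=> ? ? [].
elim: k l => [//|k IHk]; elim=> [//|l IHl].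
rewrite delannoySS !cat_uniq !map_inj_uniq ?IHk ?IHl //=.
rewrite andbT -!all_predC; apply/andP; split; apply/allP => p; rewrite ?mem_cat.
  by case/orP=> /mapP[q _ ->] /=; rewrite mem_map_cons.
by case/mapP=> q _ -> /=; rewrite mem_map_cons.
Qed.

(** The default [posn1] and the step [(false, false)] are never met on a path of
    [delannoy (size u) (size v)]. *)
Definition path_letter (s : bool * bool) (u v : word) : posn :=
  match s with
  | (true, true) => posn_add (head posn1 u) (head posn1 v)
  | (true, false) => head posn1 u
  | _ => head posn1 v
  end.

Fixpoint path_word (p : steps) (u v : word) : word :=
  if p is s :: p' then
    path_letter s u v ::
      path_word p' (if s.1 then behead u else u) (if s.2 then behead v else v)
  else [::].

Lemma size_path_word p u v : size (path_word p u v) = size p.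
Proof. by elim: p u v => //= s p IHp u v; rewrite IHp. Qed.

(** The steps before [j] have consumed as many letters of each word as they have components [true]
    on that side. *)
Lemma nth_path_word p u v j : j < size p ->
  nth posn1 (path_word p u v) j =
  path_letter (nth (false, false) p j)
    (drop (count fst (take j p)) u) (drop (count snd (take j p)) v).
Proof.
elim: p u v j => //= -[x y] p IHp u v [|j] jp /=; first by rewrite !drop0.
by rewrite IHp //; case: x y => [] []; rewrite ?add1n -?drop1 ?drop_drop ?addn1.
Qed.

(** * Increasing maps between finite ordinals and their images *)

Section Increasing.
Variables k n : nat.
Implicit Types f g : 'I_k -> 'I_n.

Definition increasing f := forall i j : 'I_k, i < j -> f i < f j.

Lemma increasing_lt f i j : increasing f -> (f i < f j) = (i < j).
Proof.
move=> incf; apply/idP/idP => [|/incf//]; apply: contraTT.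
rewrite -!leqNgt leq_eqVlt => /orP[/eqP/val_inj -> //|/incf]; exact: ltnW.
Qed.

Lemma increasing_inj f : increasing f -> injective f.
Proof.
move=> incf i j fij; apply: val_inj; case: (ltngtP (val i) (val j)) => // /incf.
  by rewrite fij ltnn.
by rewrite fij ltnn.
Qed.

Lemma count_codom f : increasing f -> count [in codom f] (enum 'I_n) = k.
Proof.
move=> /increasing_inj finj; rewrite -[RHS](card_ord k) -(card_codom finj).
by rewrite cardE -size_filter enumT.
Qed.

(** The points of the image below [f i] are the [f j] with [j < i]. So the argument [i] is the rank
    of [f i] in the image, which makes an increasing map recoverable from its image. *)
Lemma count_codom_take f i : increasing f ->
  count [in codom f] (take (f i) (enum 'I_n)) = i.
Proof.
move=> incf; have finj := increasing_inj incf.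
have -> : count [in codom f] (take (f i) (enum 'I_n)) =
          size [seq f j | j : 'I_k <- enum 'I_k & j < i].
  rewrite -size_filter; apply/perm_size/uniq_perm.
  - by rewrite filter_uniq // take_uniq // enum_uniq.
  - by rewrite map_inj_uniq // filter_uniq // enum_uniq.
  move=> x; rewrite mem_filter in_take ?mem_enum // index_enum_ord.
  apply/andP/mapP => [[/codomP[j ->]]|[j]].
    by rewrite increasing_lt // => ji; exists j => //; rewrite mem_filter ji mem_enum.
  by rewrite mem_filter => /andP[ji _] ->; rewrite codom_f increasing_lt.
rewrite size_map size_filter -(count_map val (ltn^~ i)) val_enum_ord.
by rewrite -size_filter (@filter_iota_ltn 0 k i) ?size_iota // ltnW.
Qed.

Lemma increasing_ext f g : increasing f -> increasing g ->
  (codom f =i codom g) -> f =1 g.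
Proof.
move=> incf incg fg i; have : f i \in codom g by rewrite -fg codom_f.
case/codomP=> j fij; rewrite fij; congr g; apply: val_inj => /=.
rewrite -(count_codom_take i incf) -(count_codom_take j incg) fij.
by apply: eq_count => x /=; rewrite fg.
Qed.

(** The map lists the selected positions in increasing order. *)
Lemma increasing_of_mask (m : bitseq) : size m = n -> count id m = k ->
  exists2 f, increasing f & forall j : 'I_n, (j \in codom f) = nth false m j.
Proof.
move=> sm cm; set s := mask m (enum 'I_n).
have ss : size s == k by rewrite size_mask ?cm // size_enum_ord.
have sorted_s : sorted (relpre val ltn) s.
  apply: (sorted_mask (fun x y z => @ltn_trans (val x) (val y) (val z))).
  by have := iota_ltn_sorted 0 n; rewrite -val_enum_ord sorted_map.
exists (tnth (Tuple ss)) => [i j ij|j].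
  pose x0 := tnth (Tuple ss) i; rewrite (tnth_nth x0 _ i) (tnth_nth x0 _ j) /=.
  apply: (sorted_ltn_nth _ _ sorted_s) => //.
  - by move=> x y z; exact: ltn_trans.
  - by rewrite inE (eqP ss).
  - by rewrite inE (eqP ss).
by rewrite codomE map_tnth_enum in_mask ?enum_uniq // ?index_enum_ord ?mem_enum.
Qed.

Lemma filter_codom f i : injective f ->
  [seq j <- enum 'I_k | f j == f i] = [:: i].
Proof.
move=> finj; rewrite -(@filter_pred1_uniq _ (enum 'I_k)) ?enum_uniq ?mem_enum //.
by apply: eq_filter => j; rewrite /= inj_eq.
Qed.

Lemma filter_notin_codom f x : x \notin codom f ->
  [seq j <- enum 'I_k | f j == x] = [::].
Proof.
move=> xf; rewrite -(filter_pred0 (enum 'I_k)); apply: eq_filter => j /=.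
by apply: contraNF xf => /eqP <-; exact: codom_f.
Qed.

End Increasing.

(** * Quasi-shuffles correspond to Delannoy paths *)

Section QuasiShuffles.
Variables k l n : nat.
Implicit Types sigma tau : {ffun 'I_(k + l) -> 'I_n}.

Definition qsh_left sigma (i : 'I_k) := sigma (lshift l i).
Definition qsh_right sigma (i : 'I_l) := sigma (rshift k i).

Definition qsh_step sigma (j : 'I_n) : bool * bool :=
  (j \in codom (qsh_left sigma), j \in codom (qsh_right sigma)).

Definition qsh_path sigma : steps := [seq qsh_step sigma j | j <- enum 'I_n].

Lemma size_qsh_path sigma : size (qsh_path sigma) = n.
Proof. by rewrite size_map size_enum_ord. Qed.

Lemma nth_qsh_path sigma (j : 'I_n) s0 : nth s0 (qsh_path sigma) j = qsh_step sigma j.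
Proof. by rewrite (nth_map j) ?size_enum_ord // nth_ord_enum. Qed.

Lemma is_qshP sigma : reflect
  [/\ forall j, (qsh_step sigma j).1 || (qsh_step sigma j).2,
      increasing (qsh_left sigma) & increasing (qsh_right sigma)]
  (is_qsh sigma).
Proof.
apply: (iffP and3P) => [[/forallP surj incl incr]|[surj incl incr]]; split.
- move=> j; have /existsP[i /eqP <-] := surj j.
  by case: (split_ordP i) => a ->; apply/orP; [left|right]; exact: codom_f.
- by move=> i j; have /forallP/(_ i)/forallP/(_ j)/implyP := incl.
- by move=> i j; have /forallP/(_ i)/forallP/(_ j)/implyP := incr.
- apply/forallP => j; apply/existsP.
  case/orP: (surj j) => /codomP[i ->]; [exists (lshift l i)|exists (rshift k i)]; exact: eqxx.
- by apply/forallP => i; apply/forallP => j; apply/implyP; exact: incl.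
- by apply/forallP => i; apply/forallP => j; apply/implyP; exact: incr.
Qed.

Lemma qsh_path_mem sigma : is_qsh sigma -> qsh_path sigma \in delannoy k l.
Proof.
case/is_qshP=> surj incl incr.
have left_k : count fst (qsh_path sigma) = k by rewrite count_map; exact: count_codom incl.
have right_l : count snd (qsh_path sigma) = l by rewrite count_map; exact: count_codom incr.
rewrite mem_delannoy left_k right_l !eqxx !andbT.
by apply/allP => s /mapP[j _ ->]; exact: surj.
Qed.

Lemma qsh_path_inj : {in @is_qsh k l n &, injective qsh_path}.
Proof.
move=> sigma tau /is_qshP[_ sl sr] /is_qshP[_ tl tr] st.
have step j : qsh_step sigma j = qsh_step tau j.
  by rewrite -!(nth_qsh_path _ _ (false, false)) st.
have left_eq := increasing_ext sl tl (fun j => congr1 fst (step j)).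
have right_eq := increasing_ext sr tr (fun j => congr1 snd (step j)).
by apply/ffunP => i; case: (split_ordP i) => a ->; [exact: left_eq|exact: right_eq].
Qed.

(** The two components of the path are masks for the images of the two halves, and gluing the two
    increasing maps gives the quasi-shuffle. *)
Lemma qsh_path_surj p : p \in delannoy k l -> size p = n ->
  exists2 sigma, is_qsh sigma & qsh_path sigma = p.
Proof.
rewrite mem_delannoy => /and3P[/(all_nthP (false, false)) p_all /eqP kp /eqP lp] np.
have [||f incf fp] := @increasing_of_mask k n (map fst p); rewrite ?size_map ?count_map //.
have [||g incg gp] := @increasing_of_mask l n (map snd p); rewrite ?size_map ?count_map //.
pose sigma := [ffun i => match split i with inl a => f a | inr b => g b end].
have left_f : qsh_left sigma =1 f.
  by move=> i; rewrite /qsh_left ffunE (unsplitK (inl i)).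
have right_g : qsh_right sigma =1 g.
  by move=> i; rewrite /qsh_right ffunE (unsplitK (inr i)).
have step j : qsh_step sigma j = nth (false, false) p j.
  rewrite /qsh_step (eq_codom left_f) (eq_codom right_g) fp gp.
  by rewrite !(nth_map (false, false)) ?np //; case: nth.
exists sigma; last first.
  apply: (@eq_from_nth _ (false, false)) => [|j]; first by rewrite size_qsh_path.
  by rewrite size_qsh_path => jn; rewrite -(step (Ordinal jn)) -(nth_qsh_path _ _ (false, false)).
apply/is_qshP; split=> [j|i j|i j].
- by rewrite step p_all // np.
- by rewrite !left_f; exact: incf.
- by rewrite !right_g; exact: incg.
Qed.

End QuasiShuffles.

(** * Sums over quasi-shuffles as sums over paths *)

Lemma enum_ordD m n : enum 'I_(m + n) =
  map (@lshift m n) (enum 'I_m) ++ map (@rshift m n) (enum 'I_n).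
Proof.
apply: (inj_map val_inj); rewrite val_enum_ord iotaD map_cat; congr (_ ++ _).
  by rewrite -val_enum_ord -[RHS]map_comp; exact: eq_map.
by rewrite add0n -[X in iota X _]addn0 iotaDl -val_enum_ord -[LHS]map_comp -[RHS]map_comp.
Qed.

(** By injectivity the fibre has at most one point, whose rank is the number of image points before
    [j]; the boolean serves as the length 0 or 1 of the list. *)
Lemma map_fibre (T : Type) k n (f : 'I_k -> 'I_n) (g : nat -> T) (j : 'I_n) :
  increasing f ->
  [seq g (val i) | i <- enum 'I_k & f i == j] =
  nseq (j \in codom f) (g (count [in codom f] (take j (enum 'I_n)))).
Proof.
move=> incf; have [|jf] := boolP (j \in codom f); last by rewrite filter_notin_codom.
case/codomP=> i ->; rewrite filter_codom; last exact: increasing_inj.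
by rewrite count_codom_take.
Qed.

Lemma qsh_wordE u v n (sigma : {ffun 'I_(size u + size v) -> 'I_n}) :
  is_qsh sigma -> qsh_word (u ++ v) sigma = path_word (qsh_path sigma) u v.
Proof.
move=> /is_qshP[surj incl incr]; apply: (@eq_from_nth _ posn1).
  by rewrite size_path_word !size_map.
move=> j; rewrite size_map size_enum_ord => jn.
set j' := Ordinal jn; rewrite nth_path_word ?size_qsh_path //.
rewrite (nth_map j') ?size_enum_ord // (nth_ord_enum j' j') (nth_qsh_path _ j').
rewrite /qsh_path -map_take !count_map /block_letter.
have -> : [seq nth posn1 (u ++ v) (val i) | i <- enum [set i | sigma i == j']%SET] =
    [seq nth posn1 u (val i) | i <- enum 'I_(size u) & qsh_left sigma i == j'] ++
    [seq nth posn1 v (val i) | i <- enum 'I_(size v) & qsh_right sigma i == j'].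
  have -> : enum [set i | sigma i == j']%SET =
      [seq i <- enum 'I_(size u + size v) | sigma i == j'].
    by rewrite enumT; apply: eq_filter => i; exact: finset.in_set.
  rewrite enum_ordD filter_cat map_cat; congr (_ ++ _);
    rewrite filter_map -[LHS]map_comp; apply: eq_map => i /=.
    by rewrite nth_cat ltn_ord.
  by rewrite nth_cat ltnNge leq_addr /= addKn.
rewrite (map_fibre (nth posn1 u) j' incl) (map_fibre (nth posn1 v) j' incr).
have nth_head (w : word) m : head posn1 (drop m w) = nth posn1 w m.
  by rewrite -nth0 nth_drop addn0.
(* Surjectivity excludes the empty fibre; in the other three cases the block has one letter, or one
   from each word with that of [u] on the left. *)
have := surj j'; rewrite /qsh_step /= /path_letter !nth_head.
by case: (j' \in codom (qsh_left sigma)); case: (j' \in codom (qsh_right sigma)).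
Qed.

(** The steps [(true, false)], [(false, true)] and [(true, true)] give the fibres that define [≺],
    [≻] and [⊙], so that the three sums are treated at once. *)
Definition initial_fibre (k l : nat) (s : bool * bool) : {set 'I_(k + l)} :=
  [set i : 'I_(k + l) | s.1 && (val i == 0) || s.2 && (val i == k)]%SET.

Lemma increasing_eq0 k n (f : 'I_k -> 'I_n.+1) i : increasing f ->
  (f i == ord0) = (ord0 \in codom f) && (val i == 0).
Proof.
move=> incf; apply/eqP/andP => [fi0|[/codomP[j f0] /eqP i0]].
  split; first by rewrite -fi0 codom_f.
  rewrite -leqn0 leqNgt; apply/negP => i_gt0.
  have k_gt0 : 0 < k by apply: leq_ltn_trans (ltn_ord i).
  by have := incf (Ordinal k_gt0) i i_gt0; rewrite fi0.
have [ij|ij|/val_inj -> //] := ltngtP (val i) (val j).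
  by have := incf _ _ ij; rewrite -f0.
by move: ij; rewrite i0.
Qed.

(** Each half is increasing, so only its first element can be sent to the first value. The fibre is
    thus known once it is known which halves meet it. *)
Lemma qsh_initial_fibre k l n (sigma : {ffun 'I_(k + l) -> 'I_n.+1}) s :
  0 < k -> 0 < l -> is_qsh sigma ->
  ([set i | sigma i == ord0]%SET == initial_fibre k l s) = (qsh_step sigma ord0 == s).
Proof.
move=> k_gt0 l_gt0 /is_qshP[_ incl incr].
have fibre_left t (a : 'I_k) : (lshift l a \in initial_fibre k l t) = t.1 && (val a == 0).
  by rewrite finset.inE /= (ltn_eqF (ltn_ord a)) andbF orbF.
have fibre_right t (b : 'I_l) : (rshift k b \in initial_fibre k l t) = t.2 && (val b == 0).
  rewrite finset.inE /= addn_eq0 (gtn_eqF k_gt0) andbF /=; congr (_ && _).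
  by rewrite -[X in _ == X]addn0 eqn_add2l.
apply/eqP/eqP => [/setP fibre|<-]; last first.
  apply/setP => i; rewrite finset.inE; case: (split_ordP i) => a ->.
    by rewrite fibre_left -(increasing_eq0 _ incl).
  by rewrite fibre_right -(increasing_eq0 _ incr).
rewrite [s]surjective_pairing; congr (_, _).
  have := fibre (lshift l (Ordinal k_gt0)).
  by rewrite fibre_left andbT finset.inE (increasing_eq0 (Ordinal k_gt0) incl) andbT.
have := fibre (rshift k (Ordinal l_gt0)).
by rewrite fibre_right andbT finset.inE (increasing_eq0 (Ordinal l_gt0) incr) andbT.
Qed.

Import GRing.Theory.
Local Open Scope ring_scope.

Lemma qsh_sumE (R : realType) (u v : word) (s : bool * bool) :
  (0 < size u)%N -> (0 < size v)%N -> s.1 || s.2 ->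
  qsh_sum R (initial_fibre (size u) (size v) s) =
  \sum_(p <- delannoy (size u - s.1) (size v - s.2)) chain R (path_word (s :: p) u v).
Proof.
move=> u_gt0 v_gt0 s_neq0; set k := size u; set l := size v.
(* Every step consumes at least one letter, and [s] has already taken one. *)
have small p : p \in delannoy (k - s.1) (l - s.2) -> (size p < k + l)%N.
  rewrite mem_delannoy => /and3P[p_all /eqP kp /eqP lp].
  have : (size p <= count fst p + count snd p)%N.
    elim: p p_all {kp lp} => //= -[x y] p IHp /andP[xy /IHp le_p].
    by rewrite addnACA -add1n leq_add //; case: x y xy => [] [].
  rewrite kp lp; case: s s_neq0 {kp lp} => [[] []] //= _;
    rewrite -/k -/l in u_gt0 v_gt0 *; lia.
have cons_s p : (p \in delannoy (k - s.1) (l - s.2)) = (s :: p \in delannoy k l).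
  rewrite !mem_delannoy /= s_neq0; case: all => //=; rewrite -/k -/l in u_gt0 v_gt0.
  by case: s {small s_neq0} => [[] []] /=; apply/andP/andP => -[/eqP ? /eqP ?];
    split; apply/eqP; lia.
have kl_gt0 : (0 < k + l)%N by rewrite addn_gt0 u_gt0.
(* The paths are sorted by length: [p] of length [n] matches quasi-shuffles onto ['I_n.+1], as
   [s :: p] has one more step. By [small] the default of [insubd] is not reached. *)
rewrite big_seq (partition_big
  (fun p : steps => insubd (Ordinal kl_gt0) (size p) : 'I_(k + l)) xpredT) //=.
apply: eq_bigr => n _.
transitivity (\sum_(q <- [seq qsh_path sigma | sigma <- index_enum {ffun 'I_(k + l) -> 'I_n.+1}
    & is_qsh sigma && (qsh_step sigma ord0 == s)]) chain R (path_word q u v)).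
  rewrite big_map big_filter; apply: eq_big => [sigma|sigma /andP[qsh _]].
    by case qsh: (is_qsh sigma); rewrite //= qsh_initial_fibre.
  by rewrite qsh_wordE.
transitivity (\sum_(q <- [seq s :: p | p <- delannoy (k - s.1) (l - s.2) & size p == n])
    chain R (path_word q u v)); last first.
  rewrite big_map big_filter [LHS]big_seq_cond; apply: eq_bigl => p.
  have [/small p_kl|//] := boolP (p \in _).
  by rewrite -val_eqE val_insubd p_kl.
apply: perm_big; apply: uniq_perm.
- rewrite map_inj_in_uniq ?filter_uniq ?index_enum_uniq // => sigma tau.
  rewrite !mem_filter => /andP[/andP[qs _] _] /andP[/andP[qt _] _].
  exact: qsh_path_inj.
- by rewrite map_inj_uniq ?filter_uniq ?uniq_delannoy // => p q [].
move=> q; apply/mapP/mapP => [[sigma]|[p]].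
  rewrite mem_filter => /andP[/andP[qsh /eqP step0] _] ->.
  have := qsh_path_mem qsh; have := size_qsh_path sigma.
  rewrite /qsh_path enum_ordSl /= step0 => -[p_n] p_delannoy; eexists => //.
  by rewrite mem_filter p_n eqxx cons_s.
rewrite mem_filter => /andP[/eqP p_n]; rewrite cons_s => p_delannoy ->.
have [|sigma qsh path_sigma] := qsh_path_surj p_delannoy (n := n.+1).
  by rewrite /= p_n.
exists sigma => //; rewrite mem_filter qsh mem_index_enum andbT /=.
by move: path_sigma; rewrite /qsh_path enum_ordSl => -[-> _].
Qed.

(** * Linear and bilinear extension from words *)

Section Bilinear.
Variable R : realType.
Notation V := (chain_space R).
Implicit Types (f : word -> word -> V).

(** This reduces every multilinear identity to words, one variable at a time. *)
Lemma chain_ind (P : V -> Prop) :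
  (forall c x y, P x -> P y -> P (c *: x + y)) ->
  (forall w, P (chain R w)) -> forall x, P x.
Proof.
move=> PD Pw x; have [c <-] := chain_sum_surj x; rewrite /chain_sum.
have P0 : P 0 by rewrite -(addNr (chain R [::])) -scaleN1r; exact: PD.
elim/big_rec: _ => // w y _; exact: PD.
Qed.

(** Coordinates vanish off the support, so several supports can be replaced by their union and the
    sums compared term by term. *)
Lemma bilinear_ext_sub f (x y : V) (d e : {fset word}) :
  fsubset (msupp (chain_coords x)) d -> fsubset (msupp (chain_coords y)) e ->
  bilinear_ext f x y = \sum_(u <- d) \sum_(v <- e)
    ((chain_coords x)@_u * (chain_coords y)@_v) *: f u v.
Proof.
move=> xd ye; rewrite /bilinear_ext (big_fset_incl _ xd) /=; last first.
  by move=> u _ /mcoeff_outdom ->; rewrite big1 // => v _; rewrite mul0r scale0r.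
apply: eq_bigr => u _; rewrite (big_fset_incl _ ye) //= => v _ /mcoeff_outdom ->.
by rewrite mulr0 scale0r.
Qed.

Lemma chain_coords_linear : linear (@chain_coords R).
Proof.
move=> c x y; apply: chain_sum_inj.
apply: (etrans (chain_coordsK _)); rewrite linearP; congr (_ *: _ + _); exact/esym/chain_coordsK.
Qed.

Lemma bilinear_extDr f (x : V) : linear (bilinear_ext f x).
Proof.
move=> c y z; set X := @chain_coords R.
set E := fsetU (msupp (X (c *: y + z))) (fsetU (msupp (X y)) (msupp (X z))).
have sub := fsubset_refl (msupp (X x)).
rewrite !(bilinear_ext_sub f (e := E) sub) /E ?fsubsetUl //.
- rewrite scaler_sumr -big_split; apply: eq_bigr => u _ /=.
  rewrite scaler_sumr -big_split; apply: eq_bigr => v _ /=.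
  by rewrite /X chain_coords_linear mcoeffD mcoeffZ mulrDr scalerDl scalerA mulrCA.
- by apply: (fsubset_trans _ (fsubsetUr _ _)); exact: fsubsetUr.
- by apply: (fsubset_trans _ (fsubsetUr _ _)); exact: fsubsetUl.
Qed.

Lemma bilinear_ext_flip f (x y : V) :
  bilinear_ext f x y = bilinear_ext (fun u v => f v u) y x.
Proof.
rewrite /bilinear_ext exchange_big /=.
by apply: eq_bigr => u _; apply: eq_bigr => v _; rewrite mulrC.
Qed.

Lemma bilinear_extDl f (y : V) : linear ((bilinear_ext f)^~ y).
Proof. by move=> c x x'; rewrite !(bilinear_ext_flip f) bilinear_extDr. Qed.

Lemma bilinear_ext_addl f (x x' y : V) :
  bilinear_ext f (x + x') y = bilinear_ext f x y + bilinear_ext f x' y.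
Proof. by rewrite -[x in LHS]scale1r bilinear_extDl scale1r. Qed.

Lemma bilinear_ext_addr f (x y y' : V) :
  bilinear_ext f x (y + y') = bilinear_ext f x y + bilinear_ext f x y'.
Proof. by rewrite -[y in LHS]scale1r bilinear_extDr scale1r. Qed.

End Bilinear.

(** * Recursive formulas for the products of words *)

Definition qsh (u v : word) : seq word :=
  [seq path_word p u v | p <- delannoy (size u) (size v)].

Lemma path_word_left (u : word) : path_word (nseq (size u) (true, false)) u [::] = u.
Proof. by elim: u => //= a u ->. Qed.

Lemma path_word_right (v : word) : path_word (nseq (size v) (false, true)) [::] v = v.
Proof. by elim: v => //= a v ->. Qed.

Lemma qsh0 u : qsh u [::] = [:: u].
Proof. by rewrite /qsh /= delannoy0 /= path_word_left. Qed.

Lemma qsh0l v : qsh [::] v = [:: v].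
Proof. by rewrite /qsh /= path_word_right. Qed.

Lemma qsh_cons a u b v : qsh (a :: u) (b :: v) =
  map (cons a) (qsh u (b :: v)) ++ map (cons b) (qsh (a :: u) v) ++
  map (cons (posn_add a b)) (qsh u v).
Proof. by rewrite /qsh [size (a :: u)]/= [size (b :: v)]/= delannoySS !map_cat -!map_comp. Qed.

Section WordProducts.
Variable R : realType.
Notation chain := (chain R).

(** This is a(u * v). Since [qsh u v] is a list, a word spelled by several paths is counted with
    multiplicity. *)
Definition sum_cons (a : posn) (u v : word) := \sum_(w <- qsh u v) chain (a :: w).

Lemma word_prec_cons a u v : word_prec R (a :: u) v = sum_cons a u v.
Proof.
case: v => [|b v]; first by rewrite /sum_cons qsh0 big_seq1.
rewrite /word_prec /sum_cons /qsh big_map.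
rewrite (_ : [set i | _]%SET = initial_fibre _ _ (true, false)).
  by rewrite (@qsh_sumE R (a :: u) (b :: v)) //= subn1 ?subn0.
by apply/setP => i; rewrite !finset.inE orbF.
Qed.

Lemma word_succ_cons u b v : word_succ R u (b :: v) = sum_cons b u v.
Proof.
case: u => [|a u]; first by rewrite /sum_cons qsh0l big_seq1.
rewrite /word_succ /sum_cons /qsh big_map.
rewrite (_ : [set i | _]%SET = initial_fibre _ _ (false, true)).
  by rewrite (@qsh_sumE R (a :: u) (b :: v)) //= subn1 ?subn0.
by apply/setP => i; rewrite !finset.inE.
Qed.

Lemma word_dot_cons a u b v :
  word_dot R (a :: u) (b :: v) = sum_cons (posn_add a b) u v.
Proof.
rewrite /word_dot /sum_cons /qsh big_map.
rewrite (_ : [set i | _]%SET = initial_fibre _ _ (true, true)).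
  by rewrite (@qsh_sumE R (a :: u) (b :: v)) //= !subn1.
by apply/setP => i; rewrite !finset.inE.
Qed.

Definition word_star (u v : word) := \sum_(w <- qsh u v) chain w.

Lemma word_star_sum u v : (u != [::]) || (v != [::]) ->
  word_star u v = word_prec R u v + word_dot R u v + word_succ R u v.
Proof.
case: u v => [|a u] [|b v] // _.
- by rewrite /word_star qsh0l big_seq1 /= !add0r.
- by rewrite /word_star qsh0 big_seq1 /= !addr0.
rewrite word_prec_cons word_succ_cons word_dot_cons /word_star qsh_cons.
rewrite -addrA [X in _ = _ + X]addrC !big_cat; congr (_ + (_ + _)); exact: big_map.
Qed.

End WordProducts.

(** * The products on series and the operators putting a letter in front *)

Section Algebra.
Variable R : realType.
Notation V := (chain_space R).
Notation one := (series_one R).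
Notation A := (positive_chains (R := R)).
Local Notation "x ≺ y" := (bilinear_ext (@word_prec R) x y) (at level 40).
Local Notation "x ⊙ y" := (bilinear_ext (@word_dot R) x y) (at level 40).
Local Notation "x ≻ y" := (bilinear_ext (@word_succ R) x y) (at level 40).
Local Notation "x ⋆ y" := (bilinear_ext (@word_star R) x y) (at level 40).

(* The second argument [one] is a dummy, so that [bilinear_ext] extends a     *)
(* function of one word linearly.                                             *)
Definition prepend (a : posn) (x : V) : V :=
  bilinear_ext (fun u _ => chain R (a :: u)) x one.

Lemma prepend_chain a u : prepend a (chain R u) = chain R (a :: u).
Proof. exact: bilinear_ext_chain. Qed.

HB.instance Definition _ a :=
  GRing.isLinear.Build R V V _ (prepend a) (bilinear_extDl _ one).

Lemma prepend_star_chain a u v :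
  prepend a (chain R u ⋆ chain R v) = sum_cons R a u v.
Proof.
rewrite bilinear_ext_chain linear_sum.
by apply: eq_bigr => w _; exact: prepend_chain.
Qed.

Lemma prepend_is_linear a : linear (prepend a).
Proof. exact: bilinear_extDl. Qed.

Local Definition lin := (bilinear_extDl, bilinear_extDr, prepend_is_linear).

Lemma prependD a x y : prepend a (x + y) = prepend a x + prepend a y.
Proof. exact: linearD. Qed.

Local Definition linD := (@bilinear_ext_addl R, @bilinear_ext_addr R, prependD).

(** By linearity this is [word_prec_cons]. No positivity is asked of [x] and [y], so the rule also
    covers words of one letter and the unit on the right. *)
Lemma prec_prepend a x y : prepend a x ≺ y = prepend a (x ⋆ y).
Proof.
elim/chain_ind: x => [c x x' IHx IHx'|u].
  by rewrite !lin IHx IHx'.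
elim/chain_ind: y => [c y y' IHy IHy'|v]; first by rewrite !lin IHy IHy'.
by rewrite prepend_chain prepend_star_chain bilinear_ext_chain word_prec_cons.
Qed.

Lemma succ_prepend b x y : x ≻ prepend b y = prepend b (x ⋆ y).
Proof.
elim/chain_ind: x => [c x x' IHx IHx'|u].
  by rewrite !lin IHx IHx'.
elim/chain_ind: y => [c y y' IHy IHy'|v]; first by rewrite !lin IHy IHy'.
by rewrite prepend_chain prepend_star_chain bilinear_ext_chain word_succ_cons.
Qed.

Lemma dot_prepend a b x y :
  prepend a x ⊙ prepend b y = prepend (posn_add a b) (x ⋆ y).
Proof.
elim/chain_ind: x => [c x x' IHx IHx'|u].
  by rewrite !lin IHx IHx'.
elim/chain_ind: y => [c y y' IHy IHy'|v]; first by rewrite !lin IHy IHy'.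
by rewrite !prepend_chain prepend_star_chain bilinear_ext_chain word_dot_cons.
Qed.

Lemma one_star x : one ⋆ x = x.
Proof.
elim/chain_ind: x => [c x y IHx IHy|u]; first by rewrite !lin IHx IHy.
by rewrite bilinear_ext_chain /word_star qsh0l big_seq1.
Qed.

Lemma star_one x : x ⋆ one = x.
Proof.
elim/chain_ind: x => [c x y IHx IHy|u]; first by rewrite !lin IHx IHy.
by rewrite bilinear_ext_chain /word_star qsh0 big_seq1.
Qed.

Lemma addr3ACA (x x' y y' z z' : V) :
  x + x' + (y + y') + (z + z') = x + y + z + (x' + y' + z').
Proof. by rewrite (addrACA x) (addrACA (x + y)). Qed.

(** One factor has to begin with a letter: on the pair of units the three dummy values add up to 0,
    whereas [⋆] gives [one]. *)
Lemma star_sum_l a x y :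
  prepend a x ⋆ y = prepend a x ≺ y + prepend a x ⊙ y + prepend a x ≻ y.
Proof.
elim/chain_ind: x => [c x x' IHx IHx'|u].
  by rewrite !lin IHx IHx' !scalerDr addr3ACA.
elim/chain_ind: y => [c y y' IHy IHy'|v].
  by rewrite !lin IHy IHy' !scalerDr addr3ACA.
by rewrite prepend_chain !bilinear_ext_chain word_star_sum.
Qed.

Lemma star_sum_r b x y :
  x ⋆ prepend b y = x ≺ prepend b y + x ⊙ prepend b y + x ≻ prepend b y.
Proof.
elim/chain_ind: x => [c x x' IHx IHx'|u].
  by rewrite !lin IHx IHx' !scalerDr addr3ACA.
elim/chain_ind: y => [c y y' IHy IHy'|v].
  by rewrite !lin IHy IHy' !scalerDr addr3ACA.
by rewrite prepend_chain !bilinear_ext_chain word_star_sum ?orbT.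
Qed.

Lemma star_prepend a x b y : prepend a x ⋆ prepend b y =
  prepend a (x ⋆ prepend b y) + prepend (posn_add a b) (x ⋆ y) +
  prepend b (prepend a x ⋆ y).
Proof. by rewrite star_sum_l prec_prepend dot_prepend succ_prepend. Qed.

(** * Associativity of the quasi-shuffle product *)

Lemma posn_addA : associative posn_add.
Proof. by move=> a b c; apply: val_inj; exact: addnA. Qed.

Lemma add33_transpose (x1 x2 x3 y1 y2 y3 z1 z2 z3 : V) :
  x1 + x2 + x3 + (y1 + y2 + y3) + (z1 + z2 + z3) =
  x1 + y1 + z1 + (x2 + y2 + z2) + (x3 + y3 + z3).
Proof. by rewrite (addrACA (x1 + x2)) (addrACA x1) addr3ACA. Qed.

(** Both sides expand into seven terms, led by the letters a, b, c, their pairwise sums and a + b +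
    c. Equal leading letters match through the seven hypotheses, each of which drops at least one of
    the three letters. *)
Lemma starA_prepend a x b y c z (X := prepend a x) (Y := prepend b y)
    (Z := prepend c z) :
  (x ⋆ Y) ⋆ Z = x ⋆ (Y ⋆ Z) -> (X ⋆ y) ⋆ Z = X ⋆ (y ⋆ Z) ->
  (X ⋆ Y) ⋆ z = X ⋆ (Y ⋆ z) -> (x ⋆ y) ⋆ Z = x ⋆ (y ⋆ Z) ->
  (x ⋆ Y) ⋆ z = x ⋆ (Y ⋆ z) -> (X ⋆ y) ⋆ z = X ⋆ (y ⋆ z) ->
  (x ⋆ y) ⋆ z = x ⋆ (y ⋆ z) ->
  (X ⋆ Y) ⋆ Z = X ⋆ (Y ⋆ Z).
Proof.
move=> xYZ XyZ XYz xyZ xYz Xyz xyz.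
have XY : X ⋆ Y = prepend a (x ⋆ Y) + prepend (posn_add a b) (x ⋆ y) + prepend b (X ⋆ y).
  exact: star_prepend.
have YZ : Y ⋆ Z = prepend b (y ⋆ Z) + prepend (posn_add b c) (y ⋆ z) + prepend c (Y ⋆ z).
  exact: star_prepend.
have -> : (X ⋆ Y) ⋆ Z =
    prepend a ((x ⋆ Y) ⋆ Z) + prepend (posn_add a b) ((x ⋆ y) ⋆ Z) +
    prepend b ((X ⋆ y) ⋆ Z) +
    (prepend (posn_add a c) ((x ⋆ Y) ⋆ z) +
     prepend (posn_add (posn_add a b) c) ((x ⋆ y) ⋆ z) +
     prepend (posn_add b c) ((X ⋆ y) ⋆ z)) +
    prepend c ((X ⋆ Y) ⋆ z).
  (* Of the nine terms, the three led by [c] are collected by the transposition and refolded through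
     [XY] into [prepend c ((X ⋆ Y) ⋆ z)]. *)
  by rewrite {1}XY !linD !star_prepend add33_transpose -!linD -XY.
have -> : X ⋆ (Y ⋆ Z) =
    prepend a (x ⋆ (Y ⋆ Z)) +
    (prepend (posn_add a b) (x ⋆ (y ⋆ Z)) +
     prepend (posn_add a (posn_add b c)) (x ⋆ (y ⋆ z)) +
     prepend (posn_add a c) (x ⋆ (Y ⋆ z))) +
    (prepend b (X ⋆ (y ⋆ Z)) + prepend (posn_add b c) (X ⋆ (y ⋆ z)) +
     prepend c (X ⋆ (Y ⋆ z))).
  by rewrite {1}YZ !linD !star_prepend add33_transpose -!linD -YZ.
rewrite xYZ XyZ XYz xyZ xYz Xyz xyz posn_addA.
(* The leading letters a, a+b, b, a+c, a+b+c, b+c, c of the left side are put in the order a, a+b,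
   a+b+c, a+c, b, b+c, c of the right side. *)
by rewrite [LHS](AC (3*3*1) (1*(2*5*4)*(3*6*7))).
Qed.

Lemma starA x y z : (x ⋆ y) ⋆ z = x ⋆ (y ⋆ z).
Proof.
elim/chain_ind: x => [c x x' IHx IHx'|u]; first by rewrite !lin IHx IHx'.
elim/chain_ind: y => [c y y' IHy IHy'|v]; first by rewrite !lin IHy IHy'.
elim/chain_ind: z => [c z z' IHz IHz'|w]; first by rewrite !lin IHz IHz'.
(* The induction is on the total length, since the recursion may shorten any of the three words. *)
have [n le_n] := ubnP (size u + size v + size w).
elim: n => // n IHn in u v w le_n *.
case: u v w le_n => [|a u] [|b v] [|c w] le_n; rewrite ?one_star ?star_one //.
move: le_n; rewrite /= !addSn !addnS !ltnS => le_n.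
rewrite -!prepend_chain; apply: starA_prepend; rewrite ?prepend_chain; apply: IHn => /=; lia.
Qed.

(** * The positive part and the tridendriform axioms *)

Lemma positive_chains_subspace : subspace A.
Proof.
split=> [J [[J0 _] _] //|c x y Ax Ay J [subJ sJ]].
by apply: subJ.2; [exact: Ax | exact: Ay].
Qed.

Lemma positive_ind (P : V -> Prop) :
  (forall c x y, P x -> P y -> P (c *: x + y)) ->
  (forall a u, P (prepend a (chain R u))) -> forall x, A x -> P x.
Proof.
move=> PD Pa; apply: (@smallest_sub _ _ _ [set x | P x]).
  split=> //=; rewrite -(addNr (prepend posn1 (chain R [::]))) -scaleN1r.
  exact: PD.
by move=> _ /= [[//|a u] _ ->]; rewrite -prepend_chain.
Qed.

Lemma positive_prepend a x : A (prepend a x).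
Proof.
elim/chain_ind: x => [c x y Ax Ay|u].
  by rewrite !lin; exact: positive_chains_subspace.2.
by rewrite prepend_chain; apply: sub_gen_smallest; exists (a :: u).
Qed.

Lemma star_sum x y : A x \/ A y -> x ⋆ y = x ≺ y + x ⊙ y + x ≻ y.
Proof.
case=> [Ax|Ay].
  elim/positive_ind: x / Ax => [c x x' IHx IHx'|a u]; last exact: star_sum_l.
  by rewrite !lin IHx IHx' !scalerDr addr3ACA.
elim/positive_ind: y / Ay => [c y y' IHy IHy'|b v]; last exact: star_sum_r.
by rewrite !lin IHy IHy' !scalerDr addr3ACA.
Qed.

Lemma positive_coord x : A x -> (chain_coords x)@_[::] = 0.
Proof.
move: x; apply: positive_ind => [c x y x0 y0|a u].
  by rewrite chain_coords_linear mcoeffD mcoeffZ x0 y0 mulr0 addr0.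
by rewrite prepend_chain chain_coords_chain mcoeffU.
Qed.

Lemma bilinear_ext_on D f : bilinear_on D (@bilinear_ext R f).
Proof. by split=> *; rewrite lin. Qed.

(** In each axiom only the arguments that supply the leading letter are decomposed: the left one for
    [≺], the right one for [≻], both for [⊙]. Both sides then carry the same letter, and [starA]
    closes the case. *)
Lemma positive_tridendriform :
  tridendriform_on A (@series_prec R) (@series_dot R) (@series_succ R).
Proof.
have subA := positive_chains_subspace.
split; rewrite /series_prec /series_dot /series_succ ?/sum_product;
  try exact: bilinear_ext_on; first exact: subA.
- move=> x y Ax _; elim/positive_ind: x / Ax => [c x x' ? ?|a u].
    by rewrite !lin; exact: subA.2.
  by rewrite prec_prepend; exact: positive_prepend.
- move=> x y Ax Ay; elim/positive_ind: x / Ax => [c x x' ? ?|a u].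
    by rewrite !lin; exact: subA.2.
  elim/positive_ind: y / Ay => [c y y' ? ?|b v].
    by rewrite !lin; exact: subA.2.
  by rewrite dot_prepend; exact: positive_prepend.
- move=> x y _ Ay; elim/positive_ind: y / Ay => [c y y' ? ?|b v].
    by rewrite !lin; exact: subA.2.
  by rewrite succ_prepend; exact: positive_prepend.
- move=> x y z Ax Ay _; rewrite -star_sum; last by left.
  elim/positive_ind: x / Ax => [c x x' IHx IHx'|a u]; first by rewrite !lin IHx IHx'.
  by rewrite !prec_prepend starA.
- move=> x y z _ Ay _.
  elim/positive_ind: y / Ay => [c y y' IHy IHy'|b v]; first by rewrite !lin IHy IHy'.
  by rewrite succ_prepend !prec_prepend succ_prepend starA.
- move=> x y z Ax _ Az; rewrite -star_sum; last by left.
  elim/positive_ind: z / Az => [c z z' IHz IHz'|b w]; first by rewrite !lin IHz IHz'.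
  by rewrite !succ_prepend starA.
- move=> x y z _ Ay Az.
  elim/positive_ind: y / Ay => [c y y' IHy IHy'|b v]; first by rewrite !lin IHy IHy'.
  elim/positive_ind: z / Az => [c z z' IHz IHz'|d w]; first by rewrite !lin IHz IHz'.
  by rewrite succ_prepend !dot_prepend succ_prepend starA.
- move=> x y z Ax _ Az.
  elim/positive_ind: x / Ax => [c x x' IHx IHx'|a u]; first by rewrite !lin IHx IHx'.
  elim/positive_ind: z / Az => [c z z' IHz IHz'|d w]; first by rewrite !lin IHz IHz'.
  by rewrite prec_prepend succ_prepend !dot_prepend starA.
- move=> x y z Ax Ay _.
  elim/positive_ind: x / Ax => [c x x' IHx IHx'|a u]; first by rewrite !lin IHx IHx'.
  elim/positive_ind: y / Ay => [c y y' IHy IHy'|b v]; first by rewrite !lin IHy IHy'.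
  by rewrite dot_prepend !prec_prepend dot_prepend starA.
- move=> x y z Ax Ay Az.
  elim/positive_ind: x / Ax => [c x x' IHx IHx'|a u]; first by rewrite !lin IHx IHx'.
  elim/positive_ind: y / Ay => [c y y' IHy IHy'|b v]; first by rewrite !lin IHy IHy'.
  elim/positive_ind: z / Az => [c z z' IHz IHz'|d w]; first by rewrite !lin IHz IHz'.
  by rewrite !dot_prepend starA posn_addA.
Qed.

Lemma positive_chains_one : ~ A one.
Proof.
move/positive_coord; rewrite chain_coords_chain mcoeffUU.
by apply/eqP; exact: oner_neq0.
Qed.

Lemma positive_chains_sum x : exists y c, A y /\ x = y + c *: one.
Proof.
have subA := positive_chains_subspace.
elim/chain_ind: x => [c x x' [y [d [Ay ->]]] [y' [d' [Ay' ->]]]|[|a u]].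
- exists (c *: y + y'), (c * d + d'); split; first exact: subA.2.
  by rewrite scalerDr addrACA scalerA -scalerDl.
- by exists 0, 1; split; [exact: subA.1|rewrite add0r scale1r].
- exists (chain R (a :: u)), 0; split; last by rewrite scale0r addr0.
  by rewrite -prepend_chain; exact: positive_prepend.
Qed.

End Algebra.

Theorem proposition2p6 (R : realType) :
  augmented_tridendriform (@positive_chains R) (@series_one R)
    (@series_prec R) (@series_dot R) (@series_succ R).
Proof.
split; rewrite /series_prec /series_dot /series_succ; try exact: bilinear_ext_on.
- exact: positive_tridendriform.
- exact: positive_chains_one.
- exact: positive_chains_sum.
1-6: apply: positive_ind => [c x y IHx IHy|a u];
  [by rewrite !lin IHx IHy ?scaler0 ?addr0 | by rewrite prepend_chain bilinear_ext_chain].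
(* The total product is extended from [word_star] and not from the sum of the three word products,
   so that its value at the pair of units is [one]. *)
exists (bilinear_ext (@word_star R)); split; first exact: bilinear_ext_on.
  exact: star_sum.
exact: one_star.
Qed.
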